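(* Let $K_{it}(x,y)$ denote the kernel of $e^{-itH_\kappa}$ and $L_{it}(x,y)$ the kernel of $e^{it\Delta_\kappa}$ (with respect to the measure $h_\kappa^2(y)\,dy$), given by $$K_{it}(x,y)=\frac{M_\kappa}{(i\sin 2t)^{\frac d2+\gamma_\kappa}}\,e^{\frac i2\cot 2t\,(|x|^2+|y|^2)}E_\kappa\Big(\frac{x}{i\sin 2t},y\Big),\qquad L_{it}(x,y)=\frac{M_\kappa}{(2it)^{\gamma_\kappa+\frac d2}}\,e^{\frac{i(|x|^2+|y|^2)}{4t}}E_\kappa\Big(\frac{x}{2it},y\Big).$$ Then for $v>0$ (and all $x,y\in\mathbb R^d$), $$K_{i\frac{\tan^{-1}v}{2}}(x,y)=(1+v^2)^{\frac{d+2\gamma_\kappa}{4}}\,e^{-\frac{iv}{2}|x|^2}\,L_{iv/2}\big(x\sqrt{1+v^2},\,y\big).$$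
   Context: Fix a root system $R\subset\mathbb R^d\setminus\{0\}$ (finite, with $\sigma_\nu(R)=R$ and $R\cap\mathbb R\nu=\{\pm\nu\}$ for all $\nu\in R$, where $\sigma_\nu(x)=x-2\frac{\langle \nu,x\rangle}{|\nu|^2}\nu$), a positive subsystem $R_+$ (so $R=R_+\cup(-R_+)$ is a disjoint union separated by a hyperplane through the origin), the finite reflection group $G$ generated by $\{\sigma_\nu:\nu\in R\}$, and a non-negative multiplicity function $\kappa:R\to[0,\infty)$, i.e. $\kappa(g\nu)=\kappa(\nu)$ for all $g\in G$, $\nu\in R$. Put $\gamma_\kappa=\sum_{\nu\in R_+}\kappa(\nu)$ and $h_\kappa^2(x)=\prod_{\nu\in R_+}|\langle x,\nu\rangle|^{2\kappa(\nu)}$; it is assumed that $2\gamma_\kappa$ is a non-negative integer. $M_\kappa=\big(\int_{\mathbb R^d}e^{-|x|^2/2}h_\kappa^2(x)\,dx\big)^{-1}$. The Dunkl operators are $T_\xi f(x)=\partial_\xi f(x)+\sum_{\nu\in R_+}\kappa(\nu)\langle\nu,\xi\rangle\frac{f(x)-f(\sigma_\nu x)}{\langle\nu,x\rangle}$, $T_j=T_{e_j}$; $\Delta_\kappa=\sum_{j=1}^dT_j^2$ is the Dunkl Laplacian and $H_\kappa=-\Delta_\kappa+|x|^2$ the Dunkl Hermite operator, acting on $L^2(\mathbb R^d,h_\kappa^2(x)dx)$. $E_\kappa(x,y)=V_\kappa(e^{\langle\cdot,y\rangle})(x)$ is the Dunkl kernel, where $V_\kappa$ is the intertwining operator (the unique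 linear isomorphism of polynomials preserving homogeneous degree, with $V_\kappa1=1$ and $T_\xi V_\kappa=V_\kappa\partial_\xi$); $E_\kappa$ extends to an entire function on $\mathbb C^d\times\mathbb C^d$. Half-integer powers of $is$, $s>0$, are taken with the principal branch. *)

(* Defs.v *)
From HB Require Import structures.
From mathcomp Require Import all_boot all_order all_algebra finmap.
From mathcomp Require Import all_classical all_reals all_analysis.
From mathcomp Require Import complex.
(* mpoly's notations and some of its names clash with mathcomp-analysis. *)
From mathcomp Require Import (canonicals, coercions) mpoly.

Set Implicit Arguments.
Unset Strict Implicit.
Unset Printing Implicit Defensive.

Import Order.TTheory GRing.Theory Num.Theory.
Import numFieldNormedType.Exports.
Local Open Scope classical_set_scope.
Local Open Scope ring_scope.
Local Open Scope complex_scope.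

Local Notation "{ 'mpoly' T [ n ] }" := (mpoly.mpoly n T)
  (at level 0, T, n at level 2).

(* d-dimensional Lebesgue measure, on the library's measurable type of
   d-tuples, as the iterated product of the one-dimensional one. *)
Section LebesgueMeasureTuple.
Context {R : realType}.
Local Notation R' := (measurableTypeR R).

Definition tcons {n} (p : R' * n.-tuple R') : n.+1.-tuple R' :=
  [the n.+1.-tuple R' of p.1 :: p.2].

Section Step.
Context {n : nat}.
Variable mu : {sigma_finite_measure set (n.-tuple R') -> \bar R}.

Definition lebesgue_tcons : set (n.+1.-tuple R') -> \bar R :=
  pushforward (lebesgue_measure \x mu)%E tcons.

Let measurable_tcons : measurable_fun setT (@tcons n).
Proof. exact: measurable_cons. Qed.

Let lebesgue_tcons0 : lebesgue_tcons set0 = 0%E.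
Proof. by rewrite /lebesgue_tcons /pushforward preimage_set0 measure0. Qed.

Let lebesgue_tcons_ge0 A : (0 <= lebesgue_tcons A)%E.
Proof. exact: measure_ge0. Qed.

Let lebesgue_tcons_sigma_additive : semi_sigma_additive lebesgue_tcons.
Proof.
exact: (@measure_semi_sigma_additive _ _ _
  (measure_function_pushforward__canonical__measure_function_Measure
    (lebesgue_measure \x mu)%E measurable_tcons)).
Qed.

HB.instance Definition _ := isMeasure.Build _ _ _ lebesgue_tcons
  lebesgue_tcons0 lebesgue_tcons_ge0 lebesgue_tcons_sigma_additive.

Let lebesgue_tcons_sigma_finite : sigma_finite setT lebesgue_tcons.
Proof.
have /sigma_finiteP[F [UF ndF mF]] := sigma_finiteT (@lebesgue_measure R).
have /sigma_finiteP[G [UG ndG mG]] := sigma_finiteT mu.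
exists (fun k => [set t : n.+1.-tuple R' |
  F k (thead t) /\ G k [tuple of behead t]]).
  apply/seteqP; split=> // t _.
  have [i _ Fi] : (\bigcup_k F k) (thead t) by rewrite -UF.
  have [j _ Gj] : (\bigcup_k G k) [tuple of behead t] by rewrite -UG.
  exists (maxn i j) => //; split.
    by move: (thead t) Fi; exact/subsetPset/ndF/leq_maxl.
  by move: [tuple of behead t] Gj; exact/subsetPset/ndG/leq_maxr.
move=> k; have [mFk Fk] := mF k; have [mGk Gk] := mG k; split.
  apply: measurableI; rewrite -[X in measurable X]setTI.
    exact: measurable_tnth.
  exact: measurable_behead.
rewrite /lebesgue_tcons /pushforward.
rewrite (_ : _ @^-1` _ = F k `*` G k).
  by rewrite product_measure1E// lte_mul_pinfty// ge0_fin_numE.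
have hd p : thead (@tcons n p) = p.1 by rewrite theadE.
have tl p : [tuple of behead (@tcons n p)] = p.2 by apply/val_inj.
by apply/seteqP; split=> p /=; rewrite hd tl.
Qed.

HB.instance Definition _ := Measure_isSigmaFinite.Build _ _ _ lebesgue_tcons
  lebesgue_tcons_sigma_finite.

End Step.

Fixpoint lebesgue_tuple n : {sigma_finite_measure set (n.-tuple R') -> \bar R} :=
  if n is m.+1 then lebesgue_tcons (lebesgue_tuple m)
  else \d_ [tuple].

End LebesgueMeasureTuple.

Section ComplexFunctions.
Context {R : realType}.

Definition cexp (z : R[i]) : R[i] :=
  (expR (complex.Re z))%:C * (cos (complex.Im z) +i* sin (complex.Im z)).

Definition cmod (z : R[i]) : R := Num.sqrt (complex.Re z ^+ 2 + complex.Im z ^+ 2).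

(* Principal argument, in ]-pi, pi]; meaningless at z = 0. *)
Definition carg (z : R[i]) : R :=
  let theta := acos (complex.Re z / cmod z) in
  if 0 <= complex.Im z then theta else - theta.

Definition clog (z : R[i]) : R[i] := ln (cmod z) +i* carg z.

(* Principal branch of z ^ a; only used for z != 0. *)
Definition cpow (z : R[i]) (a : R) : R[i] := cexp (a%:C * clog z).

End ComplexFunctions.

Section Dunkl.
Context {R : realType} {d : nat}.
Local Notation vec := 'rV[R]_d.

Definition dotv (x y : vec) : R := \sum_j x 0 j * y 0 j.

(* The squared Euclidean norm; the library norm of 'rV[R]_d is the sup norm. *)
Definition sqnorm (x : vec) : R := dotv x x.

Definition reflection (nu x : vec) : vec :=
  x - (2 * dotv nu x / sqnorm nu) *: nu.

Record root_system (Rt : {fset vec}) : Prop := RootSystem {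
  root_neq0 : forall nu, nu \in Rt -> nu != 0;
  root_reflection : forall nu, nu \in Rt ->
    [fset reflection nu x | x in Rt]%fset = Rt;
  root_line : forall nu, nu \in Rt -> forall mu,
    (mu \in Rt /\ exists c : R, mu = c *: nu) <-> (mu = nu \/ mu = - nu) }.

Record positive_subsystem (Rt Rp : {fset vec}) : Prop := PositiveSubsystem {
  possub_cover : Rt = (Rp `|` [fset - nu | nu in Rp])%fset;
  possub_disjoint : [disjoint Rp & [fset - nu | nu in Rp]]%fset;
  possub_hyperplane : exists beta : vec,
    forall nu, nu \in Rp -> 0 < dotv beta nu }.

Inductive reflection_group (Rt : {fset vec}) : (vec -> vec) -> Prop :=
| RGreflection nu : nu \in Rt -> reflection_group Rt (reflection nu)
| RGid : reflection_group Rt id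
| RGcomp g h : reflection_group Rt g -> reflection_group Rt h ->
    reflection_group Rt (g \o h)
| RGinv g h : reflection_group Rt g -> cancel g h -> cancel h g ->
    reflection_group Rt h.

(* Only the values of kappa on Rt are relevant. *)
Record multiplicity (Rt : {fset vec}) (kappa : vec -> R) : Prop := Multiplicity {
  mult_ge0 : forall nu, nu \in Rt -> 0 <= kappa nu;
  mult_invariant : forall g nu, reflection_group Rt g -> nu \in Rt ->
    kappa (g nu) = kappa nu }.

Variables (Rp : {fset vec}) (kappa : vec -> R).

Definition gamma_kappa : R := \sum_(nu <- Rp) kappa nu.

Definition h2_kappa (x : vec) : R :=
  \prod_(nu <- Rp) `|dotv x nu| `^ (2 * kappa nu).

Definition vec_of_tuple (t : d.-tuple (measurableTypeR R)) : vec :=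
  \row_j tnth t j.

Definition M_kappa : R :=
  (\int[lebesgue_tuple d]_t
     (expR (- sqnorm (vec_of_tuple t) / 2) * h2_kappa (vec_of_tuple t)))^-1.

(* Meaningful as written off the hyperplanes orthogonal to the roots. *)
Definition dunkl_op (xi : vec) (f : vec -> R) (x : vec) : R :=
  'D_xi f x + \sum_(nu <- Rp)
    kappa nu * dotv nu xi * ((f x - f (reflection nu x)) / dotv nu x).

Definition peval (p : {mpoly R[d]}) (x : vec) : R := mpoly.meval (x 0) p.

Definition pderiv (xi : vec) (p : {mpoly R[d]}) : {mpoly R[d]} :=
  \sum_j xi 0 j *: mpoly.mderiv j p.

(* T_xi (V p) is again a polynomial, so it is determined by its values off the
   hyperplanes orthogonal to the roots. *)
Record intertwining (V : {linear {mpoly R[d]} -> {mpoly R[d]}}) : Prop :=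
  Intertwining {
  intertwining_bij : bijective V;
  intertwining_homog : forall n p,
    p \is mpoly.ishomog1 n (@mpoly.mdeg d) ->
    V p \is mpoly.ishomog1 n (@mpoly.mdeg d);
  intertwining1 : V 1 = 1;
  intertwiningD : forall xi p x,
    (forall nu, nu \in Rp -> dotv nu x != 0) ->
    dunkl_op xi (peval (V p)) x = peval (V (pderiv xi p)) x }.

Variable V : {linear {mpoly R[d]} -> {mpoly R[d]}}.

(* The C-linear extension of V. *)
Definition intertwiningC (p : {mpoly R[i][d]}) : {mpoly R[i][d]} :=
  \sum_(m <- mpoly.msupp p) mpoly.mcoeff m p *:
    mpoly.map_mpoly (real_complex R) (V (mpoly.mpolyX R m)).

Definition linear_form (y : 'rV[R[i]]_d) : {mpoly R[i][d]} :=
  \sum_j y 0 j *: mpoly.mpolyX R[i] (mpoly.mnm1 j).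

(* E_kappa(x, y) = V(exp <., y>)(x) on C^d x C^d, where <x, y> is bilinear and V
   acts on each homogeneous component <., y>^n / n! of the exponential. *)
Definition dunkl_kernel (x y : 'rV[R[i]]_d) : R[i] :=
  lim (series (fun n : nat => mpoly.meval (x 0)
    (intertwiningC ((n`!%:R)^-1 *: linear_form y ^+ n)) : R[i]^o) @ \oo).

Definition vecC (x : vec) : 'rV[R[i]]_d := map_mx (real_complex R) x.

Definition hermite_kernel (t : R) (x y : vec) : R[i] :=
  let w := 'i * (sin (2 * t))%:C in
  M_kappa%:C / cpow w (d%:R / 2 + gamma_kappa)
  * cexp ('i / 2 * (cos (2 * t) / sin (2 * t))%:C * (sqnorm x + sqnorm y)%:C)
  * dunkl_kernel (w^-1 *: vecC x) (vecC y).

Definition laplace_kernel (t : R) (x y : vec) : R[i] :=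
  let w := 2 * 'i * t%:C in
  M_kappa%:C / cpow w (gamma_kappa + d%:R / 2)
  * cexp ('i * (sqnorm x + sqnorm y)%:C / (4 * t%:C))
  * dunkl_kernel (w^-1 *: vecC x) (vecC y).

End Dunkl.

(* Main.v *)
Require Import Defs.
From HB Require Import structures.
From mathcomp Require Import all_boot all_order all_algebra finmap.
From mathcomp Require Import all_classical all_reals all_analysis.
From mathcomp Require Import complex ring.
From mathcomp Require Import (canonicals, coercions) mpoly.

Set Implicit Arguments.
Unset Strict Implicit.
Unset Printing Implicit Defensive.

Import Order.TTheory GRing.Theory Num.Theory.
Import numFieldNormedType.Exports.
Local Open Scope classical_set_scope.
Local Open Scope ring_scope.
Local Open Scope complex_scope.

(** Put s = sqrt (1 + v ^ 2) and theta = atan v, so that sin theta = v / s and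
    cot theta = 1 / v.  The complex number inverted in the Hermite kernel at
    time theta / 2 is then i v / s, and the one in the Laplace kernel at time
    v / 2 is i v: they differ by the positive factor 1 / s.  The three factors
    of the kernels match one by one.
    - The principal power is homogeneous under positive scaling
      ([cpow_scale]), because scaling does not change the argument; this
      produces s ^ (d / 2 + gamma) = (1 + v ^ 2) ^ ((d + 2 gamma) / 4).
    - The Gaussians match because
      (s ^ 2 |x| ^ 2 + |y| ^ 2) / (2 v) - v |x| ^ 2 / 2
        = (|x| ^ 2 + |y| ^ 2) / (2 v).
    - The Dunkl kernels are evaluated at the same point, since
      x / (i v / s) = (s x) / (i v). *)

Section ComplexPowers.
Context {R : realType}.
Implicit Types (z w : R[i]) (r a : R).

Lemma cexpD z w : cexp (z + w) = cexp z * cexp w.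
Proof.
case: z w => [a b] [c e]; rewrite /cexp /= expRD cosD sinD.
by apply/eqP; rewrite eq_complex /=; apply/andP; split; apply/eqP; ring.
Qed.

Lemma cexp_real r : cexp r%:C = (expR r)%:C.
Proof.
by apply/eqP; rewrite /cexp /= cos0 sin0 eq_complex /=
  !(mulr1, mulr0, mul0r, subr0, addr0) !eqxx.
Qed.

Lemma cmod_gt0 z : z != 0 -> 0 < cmod z.
Proof.
case: z => a b; rewrite eq_complex /= negb_and => ab0.
by rewrite /cmod /= sqrtr_gt0 lt0r paddr_eq0 ?sqr_ge0// !sqrf_eq0 negb_and ab0
  addr_ge0 ?sqr_ge0.
Qed.

Lemma cmod_scale r z : 0 <= r -> cmod (r%:C * z) = r * cmod z.
Proof.
case: z => a b r0; rewrite /cmod /= !mul0r subr0 addr0 !exprMn -mulrDr.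
by rewrite sqrtrM ?sqr_ge0// sqrtr_sqr ger0_norm.
Qed.

Lemma carg_scale r z : 0 < r -> carg (r%:C * z) = carg z.
Proof.
move=> r0; rewrite /carg cmod_scale ?(ltW r0)//.
case: z => a b /=; rewrite !mul0r subr0 addr0 pmulr_rge0//.
by rewrite -mulf_div divff ?gt_eqF// mul1r.
Qed.

Lemma clog_scale r z : 0 < r -> z != 0 -> clog (r%:C * z) = (ln r)%:C + clog z.
Proof.
move=> r0 z0; rewrite /clog carg_scale// cmod_scale ?(ltW r0)//.
rewrite lnM ?posrE ?cmod_gt0//.
by apply/eqP; rewrite eq_complex /= add0r !eqxx.
Qed.

(** Positive scaling shifts the principal logarithm by a real number and so
    never crosses the branch cut; for general complex factors the power is not
    multiplicative. *)
Lemma cpow_scale r z a : 0 < r -> z != 0 ->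
  cpow (r%:C * z) a = (r `^ a)%:C * cpow z a.
Proof.
move=> r0 z0; rewrite /cpow clog_scale// mulrDr cexpD -rmorphM/= cexp_real.
by rewrite /powR gt_eqF.
Qed.

End ComplexPowers.

Lemma sin_atan (R : realType) (v : R) : sin (atan v) = v / Num.sqrt (1 + v ^+ 2).
Proof.
have cos_gt0 : 0 < cos (atan v).
  by rewrite cos_atan invr_gt0 sqrtr_gt0 ltr_wpDr ?sqr_ge0.
by rewrite -cos_atan -[X in X * _](atanK v) /tan divfK// gt_eqF.
Qed.

Lemma sqnormZ (R : realType) (d : nat) (r : R) (x : 'rV[R]_d) :
  sqnorm (r *: x) = r ^+ 2 * sqnorm x.
Proof.
by rewrite /sqnorm /dotv mulr_sumr; apply: eq_bigr => j _; rewrite !mxE; ring.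
Qed.

Theorem lemma3p1 (R : realType) (d : nat) (Rt Rp : {fset 'rV[R]_d})
    (kappa : 'rV[R]_d -> R)
    (V : {linear mpoly.mpoly d R -> mpoly.mpoly d R})
    (HRt : root_system Rt) (HRp : positive_subsystem Rt Rp)
    (Hkappa : multiplicity Rt kappa)
    (Hgamma : exists n : nat, 2 * gamma_kappa Rp kappa = n%:R)
    (HV : intertwining Rp kappa V)
    (v : R) (hv : 0 < v) (x y : 'rV[R]_d) :
  hermite_kernel Rp kappa V (atan v / 2) x y =
  ((1 + v ^+ 2) `^ ((d%:R + 2 * gamma_kappa Rp kappa) / 4))%:C
  * cexp (- ('i * v%:C / 2) * (sqnorm x)%:C)
  * laplace_kernel Rp kappa V (v / 2) (Num.sqrt (1 + v ^+ 2) *: x) y.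
Proof.
set g := gamma_kappa Rp kappa; set s := Num.sqrt (1 + v ^+ 2).
set a := d%:R / 2 + g.
have s2 : s ^+ 2 = 1 + v ^+ 2 by rewrite sqr_sqrtr// addr_ge0 ?sqr_ge0.
have s0 : 0 < s by rewrite sqrtr_gt0 ltr_wpDr ?sqr_ge0.
have vC : v%:C != 0 by rewrite fmorph_eq0 gt_eqF.
have i0 : 'i != 0 :> R[i] by exact: neq0Ci.
have iv0 : 'i * v%:C != 0 by rewrite mulf_neq0.
have pow_s : (1 + v ^+ 2) `^ ((d%:R + 2 * g) / 4) = s `^ a.
  rewrite -s2 -powR_mulrn ?ltW// -powRrM.
  by congr (_ `^ _); rewrite /a; field.
rewrite /hermite_kernel /laplace_kernel -/g -/s pow_s sqnormZ s2.
have -> : 2 * (atan v / 2) = atan v by field.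
have -> : cos (atan v) / sin (atan v) = v^-1.
  by rewrite sin_atan cos_atan -/s; field; rewrite !gt_eqF.
rewrite sin_atan -/s.
have -> : 'i * (v / s)%:C = (s^-1)%:C * ('i * v%:C).
  by rewrite rmorphM/=; ring.
have -> : 2 * 'i * (v / 2)%:C = 'i * v%:C.
  by rewrite rmorphM/= fmorphV/= rmorph_nat; field.
rewrite -/a [g + _]addrC -/a cpow_scale ?invr_gt0//.
have -> : (s^-1 `^ a)%:C = ((s `^ a)%:C)^-1.
  by rewrite -powR_inv1 ?(ltW s0)// -powRrM mulN1r powRN fmorphV.
have -> : vecC (s *: x) = s%:C *: vecC x by rewrite /vecC map_mxZ.
have -> : (s^-1%:C * ('i * v%:C))^-1 *: vecC x =
          ('i * v%:C)^-1 *: (s%:C *: vecC x).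
  by rewrite scalerA fmorphV invfM invrK mulrC.
have -> : cexp ('i / 2 * v^-1%:C * (sqnorm x + sqnorm y)%:C) =
    cexp (- ('i * v%:C / 2) * (sqnorm x)%:C) *
    cexp ('i * ((1 + v ^+ 2) * sqnorm x + sqnorm y)%:C / (4 * (v / 2)%:C)).
  rewrite -cexpD; congr cexp.
  by rewrite !(rmorphD, rmorphM, rmorphXn, fmorphV, rmorph1, rmorph_nat)/=; field.
rewrite invfM invrK; ring.
Qed.
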